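(* The solution $\hat K = \Psi_Y\Psi_X^{-1}$ of the unweighted regression problem $$\min_{K\in\mathbb{R}^{N\times N}} \int_{\mathbb{X}} \|\Psi(x(t;\hat x)) - K\Psi(\hat x)\|_2^2\,\mathrm{d}\hat x$$ satisfies $$\hat K \in \operatorname*{arg\,min}_{K\in\mathbb{R}^{N\times N}} \int_{\mathbb{X}} \|\Psi(x(t;\hat x)) - K\Psi(\hat x)\|_W^2\,\mathrm{d}\hat x$$ for all $W \in \mathbb{R}^{N\times N}$ with $W = W^\top \ge 0$ (symmetric positive semi-definite).
   Context: Let $\mathbb{X} \subset \mathbb{R}^d$ be compact, $\eta > 0$, $D := \{x+y : x \in \mathbb{X},\ \|y\| < \eta\}$, and $f : D \to \mathbb{R}^d$ Lipschitz continuous. For $\hat x \in \mathbb{X}$ let $x(\cdot;\hat x)$ be the solution of $\dot x(t) = f(x(t))$, $x(0) = \hat x$; it is assumed to exist in $D$ on $[0,\Delta t]$ for all $\hat x \in \mathbb{X}$, for a given $\Delta t > 0$. Fix $t \in [0,\Delta t]$. Let $\psi_1,\dots,\psi_N \in L^2(D,\mathbb{R})$ be linearly independent and $\Psi := (\psi_1,\dots,\psi_N)^\top : D \to \mathbb{R}^N$; the maps $\hat x \mapsto \Psi(\hat x)$ and $\hat x \mapsto \Psi(x(t;\hat x))$ belong to $L^2(\mathbb{X},\mathbb{R}^N)$. Define $\Psi_X = \int_{\mathbb{X}} \Psi(\hat x)\Psi(\hat x)^\top\mathrm{d}\hat x$ (assumed invertible) and $\Psi_Y = \int_{\mathbb{X}}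 \Psi(x(t;\hat x))\Psi(\hat x)^\top\mathrm{d}\hat x$. For $W = W^\top \ge 0$, $\|u\|_W^2 := u^\top W u$; $\|\cdot\|_2$ is the Euclidean norm. *)

(* Defs.v *)
(* MathComp-Analysis, over an arbitrary [R : realType]. Points of R^d and vectors
   of R^N are column vectors. *)
From HB Require Import structures.
From mathcomp Require Import all_boot all_order all_algebra.
From mathcomp Require Import all_classical all_reals all_analysis.
Import Order.TTheory GRing.Theory Num.Theory.
Import numFieldNormedType.Exports.

Set Implicit Arguments.
Unset Strict Implicit.
Unset Printing Implicit Defensive.

Local Open Scope classical_set_scope.
Local Open Scope ring_scope.

(* The library has Lebesgue measure on the line only. On R^d it is built here in
   the classical way: the outer measure is the infimum of the total volumes of
   the countable covers by half-open boxes ]a, b], and Lebesgue measure is its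
   restriction to the Caratheodory-measurable sets (so it is complete). *)
Section lebesgue_measure_Rd.
Variables (R : realType) (d : nat).
Implicit Types (p : 'cV[R]_d * 'cV[R]_d) (A : set 'cV[R]_d).

Definition box p : set 'cV[R]_d :=
  [set x | forall i, p.1 i 0 < x i 0 <= p.2 i 0].

Definition box_volume p : \bar R :=
  (\prod_(i < d) Num.max 0 (p.2 i 0 - p.1 i 0))%:E.

(* A cover is a countable, possibly finite or empty, set of boxes: the empty one
   makes the outer measure of [set0] vanish also for [d = 0], where the only box
   is the whole one-point space and has volume 1. *)
Definition box_cover A : set (set ('cV[R]_d * 'cV[R]_d)) :=
  [set C | countable C /\ A `<=` \bigcup_(p in C) box p].

Definition lebesgue_outer A : \bar R :=
  ereal_inf [set (\esum_(p in C) box_volume p)%E | C in box_cover A].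

Lemma box_volume_ge0 p : (0 <= box_volume p)%E.
Proof. by rewrite lee_fin prodr_ge0// => i _; rewrite le_max lexx. Qed.

Lemma lebesgue_outer_ge0 A : (0 <= lebesgue_outer A)%E.
Proof.
apply: le_ereal_inf_tmp => _ [C _ <-].
by apply: esum_ge0 => p _; exact: box_volume_ge0.
Qed.

Lemma lebesgue_outer0 : lebesgue_outer set0 = 0%E.
Proof.
apply/eqP; rewrite eq_le lebesgue_outer_ge0 andbT.
apply: ereal_inf_lbound; exists set0; last by rewrite esum_set0.
by split => //; exact: countable0.
Qed.

Lemma le_lebesgue_outer : {homo lebesgue_outer : A B / A `<=` B >-> (A <= B)%E}.
Proof.
move=> A B AB; apply: ereal_inf_le_tmp => _ [C [cC BC] <-].
by exists C => //; split => //; exact: subset_trans AB BC.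
Qed.

Lemma lebesgue_outer_sigma_subadditive : sigma_subadditive lebesgue_outer.
Proof.
move=> A; have [[i ioo]|] := pselect (exists i, lebesgue_outer (A i) = +oo%E).
  rewrite (eseries_pinfty _ _ ioo) ?leey// => n _.
  by rewrite -ltNye (lt_le_trans _ (lebesgue_outer_ge0 _)).
rewrite -forallNE => Aoo.
suff add2e (e : {posnum R}) : (lebesgue_outer (\bigcup_n A n) <=
    \sum_(i <oo) lebesgue_outer (A i) + e%:num%:E)%E.
  by apply/lee_addgt0Pr => _/posnumP[].
rewrite (le_trans _ (epsilon_trick _ _ _))//; last first.
  by move=> n; exact: lebesgue_outer_ge0.
pose P n C := box_cover (A n) C /\ (\esum_(p in C) box_volume p <=
  lebesgue_outer (A n) + (e%:num / (2 ^ n.+1)%:R)%:E)%E.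
have [G PG] : {G : nat -> set ('cV[R]_d * 'cV[R]_d) & forall n, P n (G n)}.
  apply: (@choice _ _ P) => n; rewrite /P.
  have Afin : lebesgue_outer (A n) \is a fin_num.
    by rewrite ge0_fin_numE ?lebesgue_outer_ge0// ltey; exact/eqP/Aoo.
  have en : (0 < e%:num / (2 ^ n.+1)%:R :> R) by [].
  have [_ [C CA <-] CS] := lb_ereal_inf_adherent en Afin.
  by exists C; split => //; exact/ltW.
pose H := seqDU G.
have HG : \bigcup_n H n = \bigcup_n G n by rewrite /H -seqDU_bigcup_eq.
apply: (@le_trans _ _ (\esum_(p in \bigcup_n H n) box_volume p)).
  apply: ereal_inf_lbound; exists (\bigcup_n H n) => //; split.
    by rewrite HG; apply: bigcup_countable => // n _; exact: (PG n).1.1.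
  move=> x [n _ Anx]; rewrite HG.
  by have [p Gp px] := (PG n).1.2 _ Anx; exists p => //; exists n.
rewrite nneseries_sum_bigcup; last 2 first.
- exact: trivIset_seqDU.
- exact: box_volume_ge0.
apply: lee_nneseries => [n _ _|n _].
  by apply: esum_ge0 => p _; exact: box_volume_ge0.
apply: le_trans (PG n).2; rewrite esum_mkcond [leRHS]esum_mkcond.
apply: le_esum => p _; case: ifPn => [|_].
  by rewrite inE => Hp; rewrite mem_set//; exact: subset_seqDU Hp.
by case: ifP => // _; exact: box_volume_ge0.
Qed.

HB.instance Definition _ := isOuterMeasure.Build R 'cV[R]_d lebesgue_outer
  lebesgue_outer0 lebesgue_outer_ge0 le_lebesgue_outer
  lebesgue_outer_sigma_subadditive.

(* R^d equipped with the Lebesgue sigma-algebra. *)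
Definition lebesgueRd :=
  caratheodory_type (lebesgue_outer : {outer_measure set 'cV[R]_d -> \bar R}).

Definition lebesgue_measureRd : {measure set lebesgueRd -> \bar R} :=
  (lebesgue_outer : {outer_measure set 'cV[R]_d -> \bar R}).

End lebesgue_measure_Rd.
Arguments lebesgue_measureRd {R d}.

Section definitions.
Variables (R : realType) (d : nat).
Implicit Types (D X : set 'cV[R]_d).
Local Notation mu := (@lebesgue_measureRd R d).

(* The norm that the library puts on matrices is the sup norm. *)
Definition norm2 n (u : 'cV[R]_n) : R := Num.sqrt (\sum_(i < n) u i 0 ^+ 2).

Definition sqnormW n (W : 'M[R]_n) (u : 'cV[R]_n) : R := (u^T *m W *m u) 0 0.

Definition psd n (W : 'M[R]_n) : Prop :=
  W^T = W /\ forall u : 'cV[R]_n, 0 <= sqnormW W u.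

Definition neighborhood X (eta : R) : set 'cV[R]_d :=
  [set x + y | x in X & y in [set y | norm2 y < eta]].

(* The derivative is the limit of difference quotients within [0, T], hence
   one-sided at the two endpoints. *)
Definition solution_in D (f : 'cV[R]_d -> 'cV[R]_d) (T : R) (x0 : 'cV[R]_d)
    (x : R -> 'cV[R]_d) : Prop :=
  x 0 = x0 /\ forall s, s \in `[0, T] -> D (x s) /\
    (u - s)^-1 *: (x u - x s) @[u --> within [set` `[0, T]] s^'] --> f (x s).

(* L^2(D, R) is identified with the functions of L^2(R^d, R) that vanish outside
   of D: [g \_ D] is [g] on D and 0 elsewhere. *)
Definition L2 D (g : 'cV[R]_d -> R) : Prop := g \_ D \in Lfun mu 2%:E.

Definition L2vec D n (g : 'cV[R]_d -> 'cV[R]_n) : Prop :=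
  forall i, L2 D (fun x => g x i 0).

(* Linear independence in L^2(D, R), whose elements are classes modulo a.e.
   equality. *)
Definition L2_lin_indep D n (psi : 'I_n -> 'cV[R]_d -> R) : Prop :=
  forall c : 'I_n -> R,
    {ae mu, forall x, D x -> \sum_(i < n) c i * psi i x = 0} ->
    forall i, c i = 0.

Definition mxintegral X m n (F : 'cV[R]_d -> 'M[R]_(m, n)) : 'M[R]_(m, n) :=
  \matrix_(i, j) \int[mu]_(x in X) F x i j.

Definition argmin (T : Type) (J : T -> \bar R) : set T :=
  [set a | forall b, (J a <= J b)%E].

(* [Z] stands for the map sending an initial value [x] to the observables
   [Psi (x(t; x))] of the state reached at time [t]. *)
Definition cost2 X n (Psi Z : 'cV[R]_d -> 'cV[R]_n) (K : 'M[R]_n) : \bar R :=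
  (\int[mu]_(x in X) (norm2 (Z x - K *m Psi x) ^+ 2)%:E)%E.

Definition costW X n (W : 'M[R]_n) (Psi Z : 'cV[R]_d -> 'cV[R]_n)
    (K : 'M[R]_n) : \bar R :=
  (\int[mu]_(x in X) (sqnormW W (Z x - K *m Psi x))%:E)%E.

End definitions.

(* Main.v *)
Require Import Defs.
From mathcomp Require Import all_boot all_order all_algebra.
From mathcomp Require Import all_classical all_reals all_analysis.
Import Order.TTheory GRing.Theory Num.Theory.
Import numFieldNormedType.Exports.

Set Implicit Arguments.
Unset Strict Implicit.
Unset Printing Implicit Defensive.

Local Open Scope classical_set_scope.
Local Open Scope ring_scope.

(** Write [z] for the observables of the state reached at time [t] and [p] for
    those of the initial value, both cut off to [0] outside of the domain of
    integration, and let [G], the Gram matrix of [p], be invertible.  With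
    [Khat = (int z p^T) G^-1] the residual [e = z - Khat p] satisfies
    [int e p^T = 0]: it is orthogonal to [p] as a whole matrix of integrals,
    entry by entry, and this does not refer to any weight.  Since
    [z - K p = e + L p] with [L = Khat - K], the mixed terms of the second
    moment vanish ([gram_residual]),

      [int (z - K p) (z - K p)^T = int e e^T + int (L p) (L p)^T].

    The cost of weight [W] is the trace of [W] times this matrix
    ([integral_sqnormW]), so that it splits as a sum of the cost of [Khat] and
    of the integral of the squared [W]-seminorm of [L p] ([cost_residual]).
    The latter is nonnegative as soon as [W] is positive semi-definite, whence
    the minimality of [Khat] for every [W].

    For [W = 1], a second minimizer has [int |L p|^2 = 0], hence [L p = 0]
    almost everywhere, hence [L G = int (L p) p^T = 0] ([gram_eq0]), and
    [L = 0] because [G] is invertible. *)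

(** * Matrices of L^2 inner products *)

Section gram_matrix.
Context d (T : measurableType d) (R : realType) (mu : {measure set T -> \bar R}).

Definition L2col n (u : T -> 'cV[R]_n) : Prop :=
  forall i, (fun x => u x i 0) \in Lfun mu 2%:E.

Definition gram m n (u : T -> 'cV[R]_m) (v : T -> 'cV[R]_n) : 'M[R]_(m, n) :=
  \matrix_(i, j) \int[mu]_x (u x i 0 * v x j 0).

Let two_ge1 : (1 <= 2%:E :> \bar R)%E.
Proof. by rewrite lee_fin ler1n. Qed.

Lemma L2colD n (u v : T -> 'cV[R]_n) :
  L2col u -> L2col v -> L2col (fun x => u x + v x).
Proof.
move=> hu hv i.
have -> : (fun x => (u x + v x) i 0) =
    (fun x => u x i 0) + (fun x => v x i 0) by apply/funext => x; rewrite mxE.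
exact: (Lfun_addr_closed mu two_ge1).2.
Qed.

Lemma L2colMl m n (A : 'M[R]_(m, n)) (u : T -> 'cV[R]_n) :
  L2col u -> L2col (fun x => A *m u x).
Proof.
move=> hu i.
have -> : (fun x => (A *m u x) i 0) =
    \sum_j (A i j \o* (fun x => u x j 0)).
  apply/funext => x; rewrite mxE fct_sumE.
  by apply: eq_bigr => j _; rewrite /= mulrC.
have [Lfun0 LfunD] := Lfun_addr_closed mu two_ge1.
elim/big_ind : _ => // j _; apply: Lfun_scale; last exact: hu.
by rewrite ler1n.
Qed.

Lemma L2col_integrableM m n (u : T -> 'cV[R]_m) (v : T -> 'cV[R]_n) i j :
  L2col u -> L2col v ->
  mu.-integrable setT (EFin \o (fun x => u x i 0 * v x j 0)).
Proof. by move=> hu hv; apply/Lfun1_integrable; exact: Lfun2_mul_Lfun1. Qed.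

Lemma integral_lincomb (I : finType) (a : I -> R) (h : I -> T -> R) :
  (forall k, mu.-integrable setT (EFin \o h k)) ->
  (\int[mu]_x (\sum_k a k * h k x)%:E =
    (\sum_k a k * \int[mu]_x h k x)%:E)%E.
Proof.
move=> hI; under eq_integral do rewrite -sumEFin.
rewrite integral_sum//; last first.
  by move=> k; under eq_fun do rewrite EFinM; exact: (integrableZl _ _ (hI k)).
rewrite -sumEFin; apply: eq_bigr => k _.
under eq_integral do rewrite EFinM.
rewrite integralZl//; last exact: hI.
by rewrite EFinM fineK//; exact: integrable_fin_num (hI k).
Qed.

Lemma tr_gram m n (u : T -> 'cV[R]_m) (v : T -> 'cV[R]_n) :
  (gram u v)^T = gram v u.
Proof.
by apply/matrixP => i j; rewrite !mxE; apply: eq_Rintegral => x _; rewrite mulrC.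
Qed.

Lemma gramDl m n (u v : T -> 'cV[R]_m) (w : T -> 'cV[R]_n) :
  L2col u -> L2col v -> L2col w ->
  gram (fun x => u x + v x) w = gram u w + gram v w.
Proof.
move=> hu hv hw; apply/matrixP => i j; rewrite !mxE.
rewrite -RintegralD//; [|exact: L2col_integrableM..].
by apply: eq_Rintegral => x _; rewrite mxE mulrDl.
Qed.

Lemma gramDr m n (u v : T -> 'cV[R]_n) (w : T -> 'cV[R]_m) :
  L2col u -> L2col v -> L2col w ->
  gram w (fun x => u x + v x) = gram w u + gram w v.
Proof. by move=> hu hv hw; rewrite -tr_gram gramDl// linearD/= !tr_gram. Qed.

Lemma gramMl k m n (A : 'M[R]_(k, m)) (u : T -> 'cV[R]_m) (v : T -> 'cV[R]_n) :
  L2col u -> L2col v -> gram (fun x => A *m u x) v = A *m gram u v.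
Proof.
move=> hu hv; apply/matrixP => i j; rewrite !mxE.
under [RHS]eq_bigr do rewrite mxE.
apply: EFin_inj; rewrite -integral_lincomb; last first.
  by move=> l; exact: L2col_integrableM.
rewrite /Rintegral fineK; last first.
  by apply: integrable_fin_num => //; apply: L2col_integrableM => //; exact: L2colMl.
apply: eq_integral => x _; rewrite mxE mulr_suml.
by congr EFin; apply: eq_bigr => l _; rewrite mulrA.
Qed.

(** Expanding [u^T W u] in coordinates turns the weighted cost into a linear
    function of the second moment of [u]; the weight and the data separate. *)
Lemma integral_sqnormW n (W : 'M[R]_n) (u : T -> 'cV[R]_n) : L2col u ->
  (\int[mu]_x (sqnormW W (u x))%:E = (\tr (W *m gram u u))%:E)%E.
Proof.
move=> hu.
pose h (k : 'I_n * 'I_n) x := u x k.2 0 * u x k.1 0.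
transitivity (\int[mu]_x (\sum_k W k.1 k.2 * h k x)%:E)%E.
  apply: eq_integral => x _; congr EFin.
  rewrite /sqnormW -mulmxA mxE.
  rewrite -(pair_bigA _ (fun i j => W i j * h (i, j) x))/=.
  apply: eq_bigr => i _; rewrite !mxE mulr_sumr.
  by apply: eq_bigr => j _; rewrite /h/= mulrC mulrA.
rewrite integral_lincomb; last by move=> k; exact: L2col_integrableM.
rewrite -(pair_bigA _ (fun i j => W i j * \int[mu]_x h (i, j) x))/=.
congr EFin; apply: eq_bigr => i _; rewrite mxE.
by apply: eq_bigr => j _; rewrite mxE.
Qed.

(** The diagonal of [gram u u] consists of squared L^2 norms, so that a zero
    trace makes [u] vanish almost everywhere. *)
Lemma gram_eq0 m n (u : T -> 'cV[R]_m) (v : T -> 'cV[R]_n) :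
  L2col u -> L2col v -> \tr (gram u u) = 0 -> gram u v = 0.
Proof.
move=> hu hv tr0; apply/matrixP => i j; rewrite !mxE.
have {tr0} uu0 : gram u u i i = 0.
  have ge0 k : true -> 0 <= gram u u k k.
    by move=> _; rewrite mxE; apply: Rintegral_ge0 => x _; rewrite -expr2 sqr_ge0.
  by move/eqP: tr0; rewrite psumr_eq0// => /allP/(_ i (mem_index_enum _))/eqP.
have u0 : ae_eq mu setT (fun x => (u x i 0 * u x i 0)%:E) (cst 0%E).
  apply/(ae_eq_integral_abs mu measurableT).
    by apply: measurable_int; exact: (L2col_integrableM i i hu hu).
  rewrite -[RHS]/(0%:E) -uu0 mxE fineK; last first.
    by apply: integrable_fin_num => //; exact: L2col_integrableM.
  apply: eq_integral => x _.
  by rewrite abse_EFin ger0_norm// -expr2 sqr_ge0.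
have {}u0 : ae_eq mu setT (fun x => (u x i 0 * v x j 0)%:E) (cst 0%E).
  apply: filterS u0 => x /= + _ => /(_ Logic.I)[] /eqP.
  by rewrite mulf_eq0 orbb => /eqP ->; rewrite mul0r.
rewrite /Rintegral (ae_eq_integral (cst 0%E) _ _ _ _ u0)//.
  by rewrite integral0.
by apply: measurable_int; exact: (L2col_integrableM i j hu hv).
Qed.

End gram_matrix.

(** * Weighted least squares in an abstract measure space *)

Section least_squares.
Context d (T : measurableType d) (R : realType) (mu : {measure set T -> \bar R}).
Variables (n : nat) (p z : T -> 'cV[R]_n).
Hypotheses (hp : L2col mu p) (hz : L2col mu z).
Hypothesis Gunit : gram mu p p \in unitmx.

Let Khat : 'M[R]_n := gram mu z p *m invmx (gram mu p p).
Let res (K : 'M[R]_n) (x : T) : 'cV[R]_n := z x - K *m p x.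

Let L2_res K : L2col mu (res K).
Proof.
rewrite /res; under eq_fun do rewrite -mulNmx.
by apply: L2colD => //; exact: L2colMl.
Qed.

(** The normal equations [Khat G = int z p^T], read as orthogonality of the
    residual to every coordinate of [p]. *)
Lemma gram_residual_eq0 : gram mu (res Khat) p = 0.
Proof.
rewrite /res; under eq_fun do rewrite -mulNmx.
rewrite gramDl//; last exact: L2colMl.
by rewrite gramMl// mulNmx mulmxKV// subrr.
Qed.

(** Pythagoras for matrix-valued inner products. *)
Lemma gram_residual (K : 'M[R]_n) (L := Khat - K) :
  gram mu (res K) (res K) = gram mu (res Khat) (res Khat) +
    gram mu (fun x => L *m p x) (fun x => L *m p x).
Proof.
have hL : L2col mu (fun x => L *m p x) by exact: L2colMl.
have eL0 : gram mu (fun x => L *m p x) (res Khat) = 0.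
  by rewrite gramMl// -tr_gram gram_residual_eq0 trmx0 mulmx0.
have -> : res K = fun x => res Khat x + L *m p x.
  by apply/funext => x; rewrite /res /L mulmxBl addrA subrK.
have hs : L2col mu (fun x => res Khat x + L *m p x) by exact: L2colD.
have eL0' : gram mu (res Khat) (fun x => L *m p x) = 0.
  by rewrite -tr_gram eL0 trmx0.
by rewrite (gramDl (L2_res Khat) hL hs) !(gramDr (L2_res Khat) hL)// eL0 eL0' addr0 add0r.
Qed.

Lemma cost_residual (W K : 'M[R]_n) :
  (\int[mu]_x (sqnormW W (res K x))%:E = \int[mu]_x (sqnormW W (res Khat x))%:E
    + \int[mu]_x (sqnormW W ((Khat - K) *m p x))%:E)%E.
Proof.
rewrite !integral_sqnormW//; last exact: L2colMl.
by rewrite gram_residual mulmxDr mxtraceD.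
Qed.

Lemma weighted_least_squares_min (W K : 'M[R]_n) : psd W ->
  (\int[mu]_x (sqnormW W (res Khat x))%:E <=
   \int[mu]_x (sqnormW W (res K x))%:E)%E.
Proof.
move=> [_ W0]; rewrite (cost_residual W K) leeDl// integral_ge0// => x _.
by rewrite lee_fin.
Qed.

(** By [cost_residual], an unweighted cost that does not exceed that of [Khat]
    forces [int |L p|^2 = 0] for [L = Khat - K], hence [L G = 0]. *)
Lemma least_squares_unique (K : 'M[R]_n) :
  (\int[mu]_x (sqnormW 1%:M (res K x))%:E <=
   \int[mu]_x (sqnormW 1%:M (res Khat x))%:E)%E -> K = Khat.
Proof.
have hL : L2col mu (fun x => (Khat - K) *m p x) by exact: L2colMl.
rewrite cost_residual !integral_sqnormW// !mul1mx -EFinD lee_fin gerDl => tr_le0.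
have tr0 : \tr (gram mu (fun x => (Khat - K) *m p x)
                        (fun x => (Khat - K) *m p x)) = 0.
  apply/eqP; rewrite eq_le tr_le0 sumr_ge0// => i _.
  by rewrite mxE; apply: Rintegral_ge0 => x _; rewrite -expr2 sqr_ge0.
have := gram_eq0 hL hp tr0; rewrite gramMl// => LG0.
apply/esym/eqP; rewrite -subr_eq0; apply/eqP.
by rewrite -(mulmxK Gunit (Khat - K)) LG0 mul0mx.
Qed.

End least_squares.

(** * Cutting off outside of the domain of integration *)

Lemma sqnormW0 (R : realType) n (W : 'M[R]_n) : sqnormW W 0 = 0.
Proof. by rewrite /sqnormW mulmx0 mxE. Qed.

Lemma sqr_norm2 (R : realType) n (u : 'cV[R]_n) :
  norm2 u ^+ 2 = sqnormW 1%:M u.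
Proof.
rewrite /norm2 /sqnormW mulmx1 sqr_sqrtr; last first.
  by apply: sumr_ge0 => i _; exact: sqr_ge0.
by rewrite mxE; apply: eq_bigr => i _; rewrite mxE expr2.
Qed.

Lemma psd1 (R : realType) n : psd (1%:M : 'M[R]_n).
Proof. by split=> [|u]; rewrite ?trmx1// -sqr_norm2 sqr_ge0. Qed.

Section cutoff.
Context (R : realType) (d : nat).
Variable X : set 'cV[R]_d.
Local Notation mu := (@lebesgue_measureRd R d).

(** Membership in [L2] gives measurability of the functions extended by [0] to
    the whole space, so that all integrals over [X] are moved there. *)
Definition cutoff n (u : 'cV[R]_d -> 'cV[R]_n) (x : lebesgueRd R d) : 'cV[R]_n :=
  if x \in X then u x else 0.

Lemma L2col_cutoff n (u : 'cV[R]_d -> 'cV[R]_n) :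
  L2vec X u -> L2col mu (cutoff u).
Proof.
move=> hu i; rewrite (_ : (fun x => _) = (fun x => u x i 0) \_ X); first exact: hu.
by apply/funext => x; rewrite /cutoff patchE; case: ifP => // _; rewrite mxE.
Qed.

Lemma mxintegral_cutoff m n (u : 'cV[R]_d -> 'cV[R]_m) (v : 'cV[R]_d -> 'cV[R]_n) :
  mxintegral X (fun x => u x *m (v x)^T) = gram mu (cutoff u) (cutoff v).
Proof.
apply/matrixP => i j; rewrite !mxE Rintegral_mkcond.
apply: eq_Rintegral => x _; rewrite patchE /cutoff; case: ifP => _.
  by rewrite mxE big_ord1 mxE.
by rewrite mxE mul0r.
Qed.

Lemma costW_cutoff n (W : 'M[R]_n) (p z : 'cV[R]_d -> 'cV[R]_n) K :
  costW X W p z K =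
  (\int[mu]_x (sqnormW W (cutoff z x - K *m cutoff p x))%:E)%E.
Proof.
rewrite /costW integral_mkcond; apply: eq_integral => x _.
rewrite patchE /cutoff; case: ifP => // _.
by rewrite mulmx0 subr0 sqnormW0.
Qed.

Lemma cost2_costW n (p z : 'cV[R]_d -> 'cV[R]_n) K :
  cost2 X p z K = costW X 1%:M p z K.
Proof. by apply: eq_integral => x _; rewrite sqr_norm2. Qed.

End cutoff.

Theorem proposition8 (R : realType) (d N : nat) (X : set 'cV[R]_d) (eta : R)
    (f : 'cV[R]_d -> 'cV[R]_d) (Dt t : R) (x : 'cV[R]_d -> R -> 'cV[R]_d)
    (psi : 'I_N -> 'cV[R]_d -> R) :
  let D := neighborhood X eta in
  let Psi := fun x0 : 'cV[R]_d => \col_i psi i x0 : 'cV[R]_N in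
  let Psit := fun x0 : 'cV[R]_d => Psi (x x0 t) in
  let PsiX := mxintegral X (fun x0 => Psi x0 *m (Psi x0)^T) in
  let PsiY := mxintegral X (fun x0 => Psit x0 *m (Psi x0)^T) in
  let Khat := PsiY *m invmx PsiX in
  compact X -> 0 < eta ->
  [lipschitz f y | y in D] ->
  0 < Dt ->
  (forall x0, X x0 -> solution_in D f Dt x0 (x x0)) ->
  t \in `[0, Dt] ->
  (forall i, L2 D (psi i)) -> L2_lin_indep D psi ->
  L2vec X Psi -> L2vec X Psit ->
  PsiX \in unitmx ->
  argmin (cost2 X Psi Psit) = [set Khat] /\
  forall W : 'M[R]_N, psd W -> argmin (costW X W Psi Psit) Khat.
Proof.
move=> D Psi Psit PsiX PsiY Khat _ _ _ _ _ _ _ _ hPsi hPsit PsiXu.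
have KhatE : Khat = gram lebesgue_measureRd (cutoff X Psit) (cutoff X Psi) *m
    invmx (gram lebesgue_measureRd (cutoff X Psi) (cutoff X Psi)).
  by rewrite /Khat /PsiY /PsiX !mxintegral_cutoff.
rewrite /PsiX mxintegral_cutoff in PsiXu.
have hp := L2col_cutoff hPsi; have hz := L2col_cutoff hPsit.
have minW (W : 'M[R]_N) : psd W -> argmin (costW X W Psi Psit) Khat.
  move=> W0 K; rewrite !costW_cutoff KhatE.
  exact: (weighted_least_squares_min hp hz PsiXu).
split=> //; apply/seteqP; split=> [K /(_ Khat)|K ->].
  rewrite !cost2_costW !costW_cutoff KhatE.
  exact: (least_squares_unique hp hz PsiXu).
by move=> K'; rewrite !cost2_costW; exact: (minW _ (psd1 R N)).
Qed.
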